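(* Suppose $G$ is a simple graph with $n$ vertices and $k>1$ connected components. If $\Phi=\{\phi_i\}_{i\in[n]}$ is an $L_G(n,n-k)$-frame for $\mathbb{C}^{n-k}$, then the canonical dual frame of $\Phi$ is a non-unique spectrally optimal dual frame of $\Phi$ for $1$-erasure; that is, it is a spectrally optimal dual frame of $\Phi$ for $1$-erasure, and there is a dual frame of $\Phi$ different from the canonical dual frame which is also a spectrally optimal dual frame of $\Phi$ for $1$-erasure.
   Context: Write $[n]=\{1,\dots,n\}$; inner products on $\mathbb{C}^d$ are standard and linear in the first argument. A finite sequence $\Phi=\{\phi_i\}_{i\in[n]}$ in $\mathbb{C}^d$ is a frame for $\mathbb{C}^d$ if there are constants $0<A\le B$ with $A\|f\|^2\le\sum_{i\in[n]}|\langle f,\phi_i\rangle|^2\le B\|f\|^2$ for all $f\in\mathbb{C}^d$. Its frame operator is $S_\Phi f=\sum_{i\in[n]}\langle f,\phi_i\rangle\phi_i$ (invertible). A frame $\Psi=\{\psi_i\}_{i\in[n]}$ of $\mathbb{C}^d$ is a dual frame of $\Phi$ if $f=\sum_{i\in[n]}\langle f,\phi_i\rangle\psi_i=\sum_{i\in[n]}\langle f,\psi_i\rangle\phi_i$ for all $f\in\mathbb{C}^d$; $D_\Phi$ denotes the set of dual frames of $\Phi$. The canonical dual frame of $\Phi$ is $S_\Phi^{-1}\Phi:=\{S_\Phi^{-1}\phi_i\}_{i\in[n]}\in D_\Phi$. Spectral optimality: for $\Psi\in D_\Phi$ and $\Lambda\subset[n]$, the error operator is $E_{\Phi,\Psi,\Lambda}(f)=\sum_{i\in\Lambda}\langle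 f,\phi_i\rangle\psi_i$ on $\mathbb{C}^d$, and for $1\le r<n$, $\rho^{(r)}_{\Phi,\Psi}:=\max\{\rho(E_{\Phi,\Psi,\Lambda}):\Lambda\subset[n],\ |\Lambda|=r\}$, where $\rho(\cdot)$ is the spectral radius. Put $\rho^{(r)}_\Phi:=\min\{\rho^{(r)}_{\Phi,\widetilde\Psi}:\widetilde\Psi\in D_\Phi\}$. $\Psi\in D_\Phi$ is a spectrally optimal dual frame of $\Phi$ for $1$-erasure if $\rho^{(1)}_{\Phi,\Psi}=\rho^{(1)}_\Phi$. Graph frames: for a simple graph $G$ with $n$ vertices $v_1,\dots,v_n$ and $n-m$ connected components, the Laplacian matrix is $L(G)=D(G)-A(G)$ (degree matrix minus adjacency matrix); it has rank $m$. Write $L(G)=M\,\mathrm{diag}(\lambda_1,\dots,\lambda_m,0,\dots,0)\,M^*$ with $M$ unitary and $\lambda_1,\dots,\lambda_m$ the nonzero eigenvalues, let $M_1$ be the submatrix formed by the first $m$ columns of $M$, and let $B=\mathrm{diag}(\sqrt{\lambda_1},\dots,\sqrt{\lambda_m})M_1^*$. Then $\{B e_i\}_{i\in[n]}$, with $\{e_i\}$ the standard basis of $\mathbb{C}^n$, is a frame for $\mathbb{C}^m$; any frame arising in this way is called an $L_G(n,m)$-frame. *)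

(* Defs.v *)
From HB Require Import structures.
From mathcomp Require Import all_boot all_order all_algebra.
From mathcomp Require Import boolp classical_sets reals.
From mathcomp Require Import complex.

Set Implicit Arguments.
Unset Strict Implicit.
Unset Printing Implicit Defensive.

Import Order.TTheory GRing.Theory Num.Theory.
Local Open Scope ring_scope.
Local Open Scope complex_scope.
Local Open Scope sesquilinear_scope.

(* Vectors of C^d are row vectors.  The library's [dotmx u v] is u v^*, the
   standard inner product, linear in its first argument. *)

Definition is_frame (R : realType) (n d : nat) (Phi : 'I_n -> 'rV[R[i]]_d) : Prop :=
  exists A B : R, [/\ 0 < A, A <= B &
    forall f : 'rV[R[i]]_d,
      A%:C * dotmx f f <= \sum_(i < n) `|dotmx f (Phi i)| ^+ 2 /\
      \sum_(i < n) `|dotmx f (Phi i)| ^+ 2 <= B%:C * dotmx f f].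

(* [linfun f] is the endomorphism with underlying function f: the function
   below and the one in [error_op] are linear in their argument f. *)
Definition frame_op (R : realType) (n d : nat) (Phi : 'I_n -> 'rV[R[i]]_d) :
    'End('rV[R[i]]_d) :=
  linfun (fun f : 'rV[R[i]]_d => \sum_(i < n) dotmx f (Phi i) *: Phi i).

Definition canonical_dual (R : realType) (n d : nat) (Phi : 'I_n -> 'rV[R[i]]_d) :
    'I_n -> 'rV[R[i]]_d :=
  fun i => ((frame_op Phi)^-1)%VF (Phi i).

Definition is_dual_frame (R : realType) (n d : nat)
    (Phi Psi : 'I_n -> 'rV[R[i]]_d) : Prop :=
  is_frame Psi /\
  forall f : 'rV[R[i]]_d,
    f = \sum_(i < n) dotmx f (Phi i) *: Psi i /\
    f = \sum_(i < n) dotmx f (Psi i) *: Phi i.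

Definition error_op (R : realType) (n d : nat) (Phi Psi : 'I_n -> 'rV[R[i]]_d)
    (Lam : {set 'I_n}) : 'End('rV[R[i]]_d) :=
  linfun (fun f : 'rV[R[i]]_d => \sum_(i in Lam) dotmx f (Phi i) *: Psi i).

(* For d > 0 the set of eigenvalues is finite and nonempty, so this supremum is
   the maximum of their moduli. *)
Definition spectral_radius (R : realType) (d : nat) (T : 'End('rV[R[i]]_d)) : R :=
  sup [set x | exists2 a : R[i], passmx.leigenvalue T a & x = ComplexField.Normc.normc a]%classic.

(* rho^(r)_{Phi,Psi}; the default value 0 is harmless, since the spectral radii
   are nonnegative and, for r <= n, some set has cardinality r. *)
Definition rho_pair (R : realType) (n d : nat) (r : nat)
    (Phi Psi : 'I_n -> 'rV[R[i]]_d) : R :=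
  \big[Num.max/0]_(Lam : {set 'I_n} | #|Lam| == r)
    spectral_radius (error_op Phi Psi Lam).

Definition is_min (R : realType) (A : set R) (x : R) : Prop := A x /\ lbound A x.

(* x = rho^(r)_Phi, a relation because the minimum has to be attained. *)
Definition is_rho (R : realType) (n d : nat) (r : nat)
    (Phi : 'I_n -> 'rV[R[i]]_d) (x : R) : Prop :=
  is_min [set y | exists2 Psi, is_dual_frame Phi Psi & y = rho_pair r Phi Psi]%classic x.

Definition spectrally_optimal1 (R : realType) (n d : nat)
    (Phi Psi : 'I_n -> 'rV[R[i]]_d) : Prop :=
  is_dual_frame Phi Psi /\ is_rho 1 Phi (rho_pair 1 Phi Psi).

Record sgraph (n : nat) := SGraph {
  adj : rel 'I_n;
  adj_sym : symmetric adj;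
  adj_irr : irreflexive adj }.

Definition num_components (n : nat) (G : sgraph n) : nat := n_comp (adj G) 'I_n.

Definition adjacency_mx (R : realType) (n : nat) (G : sgraph n) : 'M[R[i]]_n :=
  \matrix_(i, j) (adj G i j)%:R.

Definition degree_mx (R : realType) (n : nat) (G : sgraph n) : 'M[R[i]]_n :=
  diag_mx (\row_i #|[set j | adj G i j]|%:R).

Definition laplacian (R : realType) (n : nat) (G : sgraph n) : 'M[R[i]]_n :=
  degree_mx R G - adjacency_mx R G.

(* [lam] lists all the eigenvalues, the nonzero ones being exactly the first m.
   They are nonnegative reals, as the Laplacian is positive semidefinite, so
   [sqrtC] is the usual square root.  Phi i is the column B e_i, as a row. *)
Definition is_LG_frame (R : realType) (n m : nat) (G : sgraph n)
    (Phi : 'I_n -> 'rV[R[i]]_m) : Prop :=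
  num_components G = (n - m)%N /\
  exists (le_mn : (m <= n)%N) (M : 'M[R[i]]_n) (lam : 'rV[R[i]]_n),
    [/\ M \is unitarymx,
        forall j : 'I_n, (lam 0 j != 0) = (j < m)%N,
        laplacian R G = M *m diag_mx lam *m M^t* &
        let M1 : 'M[R[i]]_(n, m) := colsub (widen_ord le_mn) M in
        let B : 'M[R[i]]_(m, n) :=
          diag_mx (\row_(j < m) sqrtC (lam 0 (widen_ord le_mn j))) *m M1^t* in
        forall i : 'I_n, Phi i = (col i B)^T].

(* Main.v *)
(** For a dual frame Psi write Q_ij = <psi_i, phi_j>.  The error operator of the
    erasure {i} is the rank-one map f |-> <f, phi_i> psi_i, whose spectral
    radius is |Q_ii|.  The Gram matrix of Phi is the Laplacian L, so duality
    gives L (I - Q) = 0: the columns of I - Q are constant on the connected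
    components of G.  As the phi_i also sum to 0 over each component C, every
    dual satisfies \sum_(i in C) Q_ii = |C| - 1, hence
    max_(i in C) |Q_ii| >= 1 - 1/|C|.  For the canonical dual Q is Hermitian,
    which forces Q_ii = 1 - 1/|C|, so the bound is attained on all components
    simultaneously.  Adding one fixed nonzero vector phi_j to psi_i for all i in
    a component not containing j keeps duality and, by orthogonality of
    distinct components, the diagonal of Q. *)

From HB Require Import structures.
Require Import Defs.
From mathcomp Require Import all_boot all_order all_algebra.
From mathcomp Require Import boolp classical_sets reals.
From mathcomp Require Import complex ring.

Set Implicit Arguments.
Unset Strict Implicit.
Unset Printing Implicit Defensive.

Import Order.TTheory GRing.Theory Num.Theory.
Local Open Scope ring_scope.
Local Open Scope sesquilinear_scope.

(** * Quadratic form and kernel of the graph Laplacian *)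

Section LaplacianKernel.
Variables (R : realType) (n : nat) (G : sgraph n).
Local Notation L := (laplacian R G).
Local Notation conn := (connect (adj G)).

Lemma laplacian_sum (x : 'I_n -> R[i]) i :
  \sum_j L i j * x j = \sum_j (adj G i j)%:R * (x i - x j).
Proof.
under eq_bigr do rewrite !mxE mulrBl.
under [RHS]eq_bigr do rewrite mulrBr.
rewrite !sumrB -mulr_suml -natr_sum; congr (_ - _).
rewrite (bigD1 i) //= eqxx mulr1n big1 ?addr0.
  by rewrite -big_mkcond sum1dep_card.
by move=> j; rewrite eq_sym => /negPf ->; rewrite mulr0n mul0r.
Qed.

(** Doubling lets the double sum be added to its transpose; the terms at [(i, j)] and [(j, i)] then
    combine into a squared modulus. *)
Lemma laplacian_quad (x : 'I_n -> R[i]) :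
  (\sum_i (x i)^* * \sum_j L i j * x j) *+ 2 =
  \sum_i \sum_j (adj G i j)%:R * `|x i - x j| ^+ 2.
Proof.
under eq_bigr do rewrite laplacian_sum mulr_sumr.
rewrite mulr2n {2}exchange_big /= -big_split /=; apply: eq_bigr => i _.
rewrite -big_split /=; apply: eq_bigr => j _.
by rewrite [adj G j i]adj_sym normCK rmorphB /=; ring.
Qed.

Lemma laplacian_psd (x : 'I_n -> R[i]) :
  0 <= \sum_i (x i)^* * \sum_j L i j * x j.
Proof.
rewrite -(pmulrn_lge0 _ (ltn0Sn 1)) laplacian_quad.
by apply: sumr_ge0 => i _; apply: sumr_ge0 => j _; rewrite mulr_ge0 ?exprn_ge0.
Qed.

(** The quadratic form vanishes, hence so does each of its nonnegative terms: [x] agrees across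
    edges, then along paths. *)
Lemma laplacian_ker (x : 'I_n -> R[i]) :
  (forall i, \sum_j L i j * x j = 0) -> forall i j, conn i j -> x i = x j.
Proof.
move=> Lx0; have edge i j : adj G i j -> x i = x j.
  move=> aij; have := laplacian_quad x.
  under eq_bigr do rewrite Lx0 mulr0.
  rewrite sumr_const mul0rn mul0rn => /esym/eqP.
  have ge0 k l : 0 <= (adj G k l)%:R * `|x k - x l| ^+ 2.
    by rewrite mulr_ge0 ?exprn_ge0.
  rewrite psumr_eq0 => [/allP/(_ i (mem_index_enum _))|k _]; last first.
    exact: sumr_ge0.
  rewrite psumr_eq0 => [/allP/(_ j (mem_index_enum _))|//].
  by rewrite aij mul1r expf_eq0 /= normr_eq0 subr_eq0 => /eqP.
move=> i j /connectP[p pth ->]; elim: p i pth => //= k p IHp i /andP[aik pth].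
by rewrite (edge _ _ aik) (IHp _ pth).
Qed.

(** The indicator of a component does not change across an edge, so the Laplacian kills it. *)
Lemma laplacian_component_sum c i : \sum_(j | conn c j) L i j = 0.
Proof.
have -> : \sum_(j | conn c j) L i j = \sum_j L i j * (conn c j)%:R.
  by rewrite big_mkcond; apply: eq_bigr => j _; case: ifP => _;
    rewrite ?mulr1 ?mulr0.
rewrite laplacian_sum big1 // => j _.
have [aij|] := boolP (adj G i j); last first.
  by rewrite mul0r.
by rewrite (same_connect1r (sym_connect_sym (@adj_sym _ G)) aij) subrr mulr0.
Qed.

Lemma laplacian_eq0 i j : ~~ conn i j -> L i j = 0.
Proof.
move=> nc; rewrite !mxE; have [eij|_] := eqVneq i j.
  by rewrite eij connect0 in nc.
by rewrite (contraNF (@connect1 _ _ _ _) nc) subrr.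
Qed.

Lemma laplacianC i j : L i j = L j i.
Proof. by rewrite !mxE adj_sym; case: eqVneq => [->|]; rewrite ?mulr0n. Qed.

End LaplacianKernel.

(** * Dual frames and the canonical dual *)

Section DualFrames.
Variables (R : realType) (n d : nat).
Local Notation V := 'rV[R[i]]_d.
Implicit Types (Phi Psi : 'I_n -> V) (f g : V).

Lemma dotmxC f g : dotmx f g = (dotmx g f)^*.
Proof.
rewrite !dotmxE !mxE rmorph_sum; apply: eq_bigr => i _ /=.
by rewrite !mxE rmorphM /= conjCK mulrC.
Qed.

Lemma dotmxZl (a : R[i]) f g : dotmx (a *: f) g = a * dotmx f g.
Proof. exact: linearZl_LR. Qed.

Lemma dotmx_suml (I : finType) (P : pred I) (F : I -> V) g :
  dotmx (\sum_(i | P i) F i) g = \sum_(i | P i) dotmx (F i) g.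
Proof. exact: linear_sumlz. Qed.

Lemma dotmx_sumr (I : finType) (P : pred I) (F : I -> V) f :
  dotmx f (\sum_(i | P i) F i) = \sum_(i | P i) dotmx f (F i).
Proof. exact: linear_sumr. Qed.

(** Evaluating [linfun] requires a linear structure on the function; it is built here once for both
    [frame_op] and [error_op]. *)
Lemma frame_lfunE (P : pred 'I_n) Phi Psi f :
  linfun (fun f : V => \sum_(i | P i) dotmx f (Phi i) *: Psi i) f =
  \sum_(i | P i) dotmx f (Phi i) *: Psi i.
Proof.
pose T := fun f : V => \sum_(i | P i) dotmx f (Phi i) *: Psi i.
have T_lin : linear T.
  move=> a u v; rewrite /T scaler_sumr -big_split; apply: eq_bigr => i _ /=.
  by rewrite linearPl scalerDl scalerA.
pose TL := GRing.isLinear.Build _ _ _ _ T T_lin.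
pose T' : {linear V -> V} := HB.pack T TL.
exact: (lfunE T').
Qed.

(** Cauchy-Schwarz term by term. Asking for [1 <= B] ensures that the inverse of one such bound lies
    below any other. *)
Lemma frame_upper Psi : exists2 B : R, 1 <= B &
  forall f, \sum_i `|dotmx f (Psi i)| ^+ 2 <= (B%:C)%C * dotmx f f.
Proof.
pose b := \sum_i dotmx (Psi i) (Psi i).
have b_ge0 : 0 <= b by apply: sumr_ge0 => i _; exact: dnorm_ge0.
have bE : b = ((complex.Re b)%:C)%C by rewrite RRe_real // ger0_real.
exists (1 + complex.Re b) => [|f].
  by rewrite lerDl -ler0c -bE.
rewrite rmorphD rmorph1 /= -bE mulrDl mul1r.
apply: (@le_trans _ _ (b * dotmx f f)); last by rewrite lerDr dnorm_ge0.
rewrite mulr_suml; apply: ler_sum => i _.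
by rewrite mulrC; apply: (CauchySchwarz (@dotmx _ d) f (Psi i)).
Qed.

(** An upper bound [A] for [Phi] yields the lower bound [A^-1] for [Psi]: expand [dotmx f f] by the
    reconstruction formula and apply AM-GM to each term. *)
Lemma dual_is_frame Phi Psi :
  (forall f, f = \sum_i dotmx f (Psi i) *: Phi i) -> is_frame Psi.
Proof.
move=> dual; have [A A1 Phi_ub] := frame_upper Phi.
have [B B1 Psi_ub] := frame_upper Psi.
have A0 : 0 < A by apply: lt_le_trans A1.
exists A^-1, B; split; rewrite ?invr_gt0 //.
  by apply: le_trans B1; rewrite invf_le1.
move=> f; split => //.
rewrite fmorphV ler_pdivrMl ?ltcR //.
have AC : 0 < (A%:C)%C :> R[i] by rewrite ltcR.
(* AM-GM: 2 A |a b| <= A^2 |a|^2 + |b|^2 *)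
have amgm i : (A%:C)%C * `|dotmx f (Psi i) * dotmx (Phi i) f| *+ 2 <=
    (A%:C)%C ^+ 2 * `|dotmx f (Psi i)| ^+ 2 + `|dotmx f (Phi i)| ^+ 2.
  rewrite normrM mulrA (dotmxC (Phi i)) norm_conjC -exprMn.
  by rewrite real_leif_mean_square_scaled ?realM ?normr_real // ger0_real ?ltW.
have ff : (A%:C)%C * dotmx f f *+ 2 <= (A%:C)%C ^+ 2 *
    (\sum_i `|dotmx f (Psi i)| ^+ 2) + \sum_i `|dotmx f (Phi i)| ^+ 2.
  have ub : dotmx f f <= \sum_i `|dotmx f (Psi i) * dotmx (Phi i) f|.
    rewrite -[leLHS]ger0_norm ?dnorm_ge0 // [X in dotmx X _](dual f).
    rewrite dotmx_suml; apply: le_trans (ler_norm_sum _ _ _) _.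
    by apply: ler_sum => i _; rewrite dotmxZl.
  rewrite [X in X + _]mulr_sumr -big_split.
  apply: le_trans (ler_sum _ (fun i _ => amgm i)).
  by rewrite sumrMnl -mulr_sumr lerMn2r ler_pM2l.
(* Adding [A * dotmx f f] to both sides turns the left side into that of [ff]; the upper bound for
   [Phi] does the rest. *)
rewrite -(ler_pM2l AC) mulrA -expr2 -(lerD2r ((A%:C)%C * dotmx f f)).
by rewrite -mulr2n (le_trans ff) // lerD2l.
Qed.

Section CanonicalDual.
Variable Phi : 'I_n -> V.
Hypothesis Phi_span : forall f, (forall i, dotmx f (Phi i) = 0) -> f = 0.
Local Notation S := (frame_op Phi).

Lemma frame_opE f : S f = \sum_i dotmx f (Phi i) *: Phi i.
Proof. exact: frame_lfunE. Qed.

Lemma dotmx_frame_op f g :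
  dotmx (S f) g = \sum_i dotmx f (Phi i) * dotmx (Phi i) g.
Proof.
by rewrite frame_opE dotmx_suml; apply: eq_bigr => i _; rewrite dotmxZl.
Qed.

Lemma frame_op_selfadjoint f g : dotmx (S f) g = dotmx f (S g).
Proof.
rewrite [RHS]dotmxC !dotmx_frame_op rmorph_sum; apply: eq_bigr => i _ /=.
by rewrite rmorphM /= -!dotmxC mulrC.
Qed.

(** [dotmx (S f) f] is the sum of the squared moduli of the coefficients of [f], so a kernel vector
    is orthogonal to every [Phi i]. *)
Lemma lker_frame_op : lker S == 0%VS.
Proof.
rewrite -subv0; apply/subvP => f; rewrite memv_ker memv0 => /eqP Sf0.
apply/eqP/Phi_span => i; have := dotmx_frame_op f f.
rewrite Sf0 linear0l => /esym/eqP; rewrite psumr_eq0 => [|j _].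
  move=> /allP/(_ i (mem_index_enum _)).
  by rewrite (dotmxC (Phi i)) mul_conjC_eq0 => /eqP.
by rewrite (dotmxC (Phi j)) mul_conjC_ge0.
Qed.

Let SK := lker0_lfunK lker_frame_op.
Let SVK := lker0_lfunVK lker_frame_op.

Lemma canonical_dual_selfadjoint i j :
  dotmx (canonical_dual Phi i) (Phi j) = dotmx (Phi i) (canonical_dual Phi j).
Proof. by rewrite -{1}[Phi j]SVK -frame_op_selfadjoint SVK. Qed.

Lemma canonical_dual_is_dual : is_dual_frame Phi (canonical_dual Phi).
Proof.
have dual1 f : f = \sum_i dotmx f (Phi i) *: canonical_dual Phi i.
  rewrite -{1}[f]SK frame_opE linear_sum; apply: eq_bigr => i _.
  by rewrite linearZ.
have dual2 f : f = \sum_i dotmx f (canonical_dual Phi i) *: Phi i.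
  rewrite -{1}[f]SVK frame_opE; apply: eq_bigr => i _; congr (_ *: _).
  by rewrite -{2}[f]SVK frame_op_selfadjoint SVK.
by split; [exact: dual_is_frame dual2|].
Qed.

End CanonicalDual.

End DualFrames.

(** * Spectral radius after a single erasure *)

Section SpectralRadius.
Variables (R : realType) (n d : nat).
Implicit Types Phi Psi : 'I_n -> 'rV[R[i]]_d.

Lemma error_op1E Phi Psi i f :
  error_op Phi Psi [set i] f = dotmx f (Phi i) *: Psi i.
Proof. by rewrite /error_op frame_lfunE big_set1. Qed.

(** Pairing [T f = a *: f] with [Phi i] forces [a = q], unless [dotmx f (Phi i)] vanishes, and then
    [a = 0]. *)
Lemma spectral_radius_error_op1 Phi Psi i : (0 < d)%N ->
  spectral_radius (error_op Phi Psi [set i]) =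
  ComplexField.Normc.normc (dotmx (Psi i) (Phi i)).
Proof.
move=> d0; set T := error_op _ _ _; set q := dotmx _ _.
have evP a : passmx.leigenvalue T a <-> exists2 f, f != 0 & T f = a *: f.
  have kerE f : (f \in passmx.leigenspace T a) = (T f == a *: f).
    by rewrite memv_ker !lfun_simp subr_eq0.
  rewrite /passmx.leigenvalue; split=> [ker0|[f f0 Tf]].
    exists (vpick (passmx.leigenspace T a)); first by rewrite vpick0.
    by apply/eqP; rewrite -kerE memv_pick.
  apply: contraNneq f0 => ker0.
  by rewrite -memv0 -ker0 kerE Tf.
have evq : passmx.leigenvalue T q.
  apply/evP; have [Psi0|Psi0] := eqVneq (Psi i) 0; last first.
    by exists (Psi i) => //; rewrite error_op1E.
  (* If [Psi i = 0], both the operator and [q] are zero, so any nonzero vector serves; one exists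
     because [0 < d]. *)
  exists (const_mx 1).
    apply/eqP => /rowP/(_ (Ordinal d0)); rewrite !mxE => /eqP.
    by rewrite oner_eq0.
  by rewrite error_op1E /q Psi0 linear0l scaler0 scale0r.
have ub : ubound [set x | exists2 a, passmx.leigenvalue T a
    & x = ComplexField.Normc.normc a]%classic (ComplexField.Normc.normc q).
  move=> _ [a /evP[f f0]] + ->; rewrite error_op1E => Tf.
  have [fPhi0|fPhi0] := eqVneq (dotmx f (Phi i)) 0.
    move: Tf; rewrite fPhi0 scale0r => /esym/eqP; rewrite scaler_eq0 (negPf f0).
    rewrite orbF => /eqP ->.
    by rewrite -lecR -[leLHS]/(`|0 : R[i]|) -[leRHS]/(`|q|) normr0.
  have := congr1 (fun g => dotmx g (Phi i)) Tf.
  by rewrite /= !dotmxZl mulrC => /(mulIf fPhi0) <-.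
apply/eqP; rewrite eq_le; apply/andP; split.
  by apply: ge_sup => //; exists (ComplexField.Normc.normc q), q.
by apply: ub_le_sup; [exists (ComplexField.Normc.normc q) | exists q].
Qed.

Lemma le_rho_pair1 Phi Psi i : (0 < d)%N ->
  ComplexField.Normc.normc (dotmx (Psi i) (Phi i)) <= rho_pair 1 Phi Psi.
Proof.
move=> d0; rewrite -spectral_radius_error_op1 //.
by apply: le_bigmax_cond; rewrite cards1.
Qed.

Lemma rho_pair1_le Phi Psi (x : R) : (0 < d)%N -> 0 <= x ->
  (forall i, ComplexField.Normc.normc (dotmx (Psi i) (Phi i)) <= x) ->
  rho_pair 1 Phi Psi <= x.
Proof.
move=> d0 x0 le_x; apply: bigmax_le => // _ /cards1P[i ->].
by rewrite spectral_radius_error_op1.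
Qed.

End SpectralRadius.

(** * Duals of a family whose Gram matrix is the Laplacian *)

Section GraphFrame.
Variables (R : realType) (n d : nat) (G : sgraph n).
Variable Phi : 'I_n -> 'rV[R[i]]_d.
Hypothesis gram : forall i j, dotmx (Phi i) (Phi j) = laplacian R G i j.
Local Notation conn := (connect (adj G)).
Local Notation normc := ComplexField.Normc.normc.
Implicit Type Psi : 'I_n -> 'rV[R[i]]_d.

(** The squared norm of the sum is a sum of Laplacian entries within one component, where row sums
    vanish. *)
Lemma frame_component_sum c : \sum_(i | conn c i) Phi i = 0.
Proof.
apply/eqP; rewrite -(dnorm_eq0 (@dotmx _ d)) /=.
rewrite dotmx_suml big1 // => i _; rewrite dotmx_sumr /=.
under eq_bigr do rewrite gram.
by rewrite laplacian_component_sum.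
Qed.

(* Since L is the Gram matrix of Phi, duality says that L kills the columns
   of I - (<psi_i, phi_j>). *)
Lemma dual_column_const Psi : is_dual_frame Phi Psi ->
  forall i i' j, conn i i' ->
  (i == j)%:R - dotmx (Psi i) (Phi j) = (i' == j)%:R - dotmx (Psi i') (Phi j).
Proof.
move=> [_ dual] i i' j.
pose x i : R[i] := (i == j)%:R - dotmx (Psi i) (Phi j).
apply: (laplacian_ker (x := x)) => l; rewrite /x.
under eq_bigr do rewrite mulrBr.
rewrite sumrB (bigD1 j) //= eqxx mulr1 big1 ?addr0; last first.
  by move=> k /negPf ->; rewrite mulr0.
rewrite -gram [X in dotmx X _ - _](dual (Phi l)).1 dotmx_suml.
rewrite -sumrB big1 // => k _.
by rewrite dotmxZl gram subrr.
Qed.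

Lemma dual_component_sum Psi c : is_dual_frame Phi Psi ->
  \sum_(i | conn c i) dotmx (Psi i) (Phi i) = #|conn c|%:R - 1.
Proof.
move=> dual.
have : \sum_(i | conn c i) (1 - dotmx (Psi i) (Phi i)) = 1.
  (* Constancy of columns moves each diagonal entry of [I - Q] to row [c]; there the [Phi i] sum to
     zero and only the Kronecker delta survives. *)
  transitivity (\sum_(i | conn c i) ((c == i)%:R - dotmx (Psi c) (Phi i))).
    apply: eq_bigr => i ci.
    by rewrite (dual_column_const dual i ci) eqxx.
  rewrite sumrB -dotmx_sumr frame_component_sum linear0r subr0.
  by rewrite (bigD1 c) ?connect0 //= eqxx big1 ?addr0 // => i /andP[_];
    rewrite eq_sym => /negPf ->.
rewrite sumrB sumr_const => /(canRL (subrK _)) E.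
by apply: (canRL (addrK _)); rewrite addrC; exact: esym E.
Qed.

Definition attains_component_bound Psi := forall i,
  dotmx (Psi i) (Phi i) = 1 - #|conn i|%:R^-1.

Lemma component_gt0 i : (0 < #|conn i|)%N.
Proof. by apply/card_gt0P; exists i; exact: connect0. Qed.

(** Constant columns and Hermitian symmetry make [I - Q] constant on each component block, so the
    component sum is shared equally by the diagonal entries. *)
Lemma selfadjoint_dual_diag Psi : is_dual_frame Phi Psi ->
  (forall i j, dotmx (Psi i) (Phi j) = dotmx (Phi i) (Psi j)) ->
  attains_component_bound Psi.
Proof.
move=> dual herm i.
pose z j := 1 - dotmx (Psi j) (Phi j).
have zz j k : conn j k -> z j = (z k)^*.
  move=> jk; have := dual_column_const dual j jk; rewrite eqxx -/(z j) => ->.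
  have kj : conn k j by rewrite (sym_connect_sym (@adj_sym _ G)).
  have := dual_column_const dual k kj; rewrite eqxx -/(z k) => ->.
  by rewrite rmorphB /= rmorph_nat eq_sym -dotmxC herm.
have zE j : conn i j -> dotmx (Psi j) (Phi j) = dotmx (Psi i) (Phi i).
  move=> ij; apply: oppr_inj; apply: (addrI 1); rewrite -/(z j) -/(z i).
  (* [zz j j] says that [z j] is real, so [z i], its conjugate, equals it. *)
  by rewrite (zz _ _ ij) -(zz j j).
have := dual_component_sum i dual; rewrite (eq_bigr _ zE) sumr_const => E.
have N0 : #|conn i|%:R != 0 :> R[i] by rewrite pnatr_eq0 -lt0n component_gt0.
apply: (mulfI N0); rewrite mulrBr mulr1 mulfV // -E.
exact: mulr_natl.
Qed.

Lemma component_bound_ge0 i : 0 <= 1 - (#|conn i|%:R^-1 : R).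
Proof.
by rewrite subr_ge0 invf_le1 ?ler1n ?ltr0n component_gt0.
Qed.

Lemma attains_component_bound_normc Psi i : attains_component_bound Psi ->
  normc (dotmx (Psi i) (Phi i)) = 1 - #|conn i|%:R^-1.
Proof.
move=> att; apply: complexI; rewrite -[LHS]/(`|dotmx (Psi i) (Phi i)|) att.
rewrite rmorphB rmorph1 fmorphV rmorph_nat ger0_norm //.
have := component_bound_ge0 i; rewrite -ler0c.
by rewrite rmorphB rmorph1 fmorphV rmorph_nat.
Qed.

(** Triangle inequality on the component sum, each of whose terms has modulus at most
    [rho_pair 1 Phi Psi]. *)
Lemma rho_pair1_ge Psi i : (0 < d)%N -> is_dual_frame Phi Psi ->
  1 - #|conn i|%:R^-1 <= rho_pair 1 Phi Psi.
Proof.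
move=> d0 dual.
have N0 : (0 : R) < #|conn i|%:R by rewrite ltr0n component_gt0.
rewrite -(ler_pM2l N0) mulrBr mulr1 mulfV ?gt_eqF // -lecR.
rewrite rmorphB rmorph1 rmorph_nat -[leLHS]ger0_norm; last first.
  by rewrite subr_ge0 ler1n component_gt0.
rewrite -(dual_component_sum i dual); apply: le_trans (ler_norm_sum _ _ _) _.
rewrite mulr_natl rmorphMn -sumr_const; apply: ler_sum => j _.
by rewrite -[leLHS]/((normc _)%:C)%C lecR le_rho_pair1.
Qed.

(** Any competing dual obeys the lower bound of every component, so its maximum dominates each
    diagonal entry of [Psi]. *)
Lemma attains_component_bound_optimal Psi : (0 < d)%N ->
  is_dual_frame Phi Psi -> attains_component_bound Psi ->
  spectrally_optimal1 Phi Psi.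
Proof.
move=> d0 dual att; split=> //; split; first by exists Psi.
move=> _ [Psi' dual' ->]; apply: rho_pair1_le => // [|i].
  rewrite /rho_pair; exact: bigmax_ge_id.
by rewrite attains_component_bound_normc // rho_pair1_ge.
Qed.

End GraphFrame.

(** * Graph frames and the perturbed dual *)

(** The Gram matrix reassembles the spectral factorization of the Laplacian; for spanning, the
    orthonormal columns of [M] separate the coordinates of [f]. *)
Lemma LG_frame_gram (R : realType) (n d : nat) (G : sgraph n)
    (Phi : 'I_n -> 'rV[R[i]]_d) : is_LG_frame G Phi ->
  (forall i j, dotmx (Phi i) (Phi j) = laplacian R G i j) /\
  (forall f, (forall i, dotmx f (Phi i) = 0) -> f = 0).
Proof.
move=> [_ [le_dn [M [lam [M_unitary lam_neq0 LE PhiE]]]]].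
have MM k k' : \sum_i (M i k)^* * M i k' = (k == k')%:R.
  have /unitarymxP/mulmx1C/matrixP/(_ k k') := M_unitary.
  by rewrite !mxE => <-; apply: eq_bigr => i _; rewrite !mxE.
have LM i k : \sum_j laplacian R G i j * M j k = lam 0 k * M i k.
  have /matrixP/(_ i k) : laplacian R G *m M = M *m diag_mx lam.
    rewrite LE -mulmxA (_ : M^t* *m M = 1%:M) ?mulmx1 //.
    exact/mulmx1C/unitarymxP.
  by rewrite mul_mx_diag !mxE mulrC.
(* Each eigenvalue is the quadratic form at a unit column of [M]; its sign makes [sqrtC] real
   below. *)
have lam_ge0 k : 0 <= lam 0 k.
  have := laplacian_psd G (M ^~ k).
  under eq_bigr do rewrite LM mulrCA.
  by rewrite -mulr_sumr MM eqxx mulr1.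
pose w := widen_ord le_dn.
have PhiE' i l : Phi i 0 l = sqrtC (lam 0 (w l)) * (M i (w l))^*.
  by rewrite PhiE mul_diag_mx !mxE.
split=> [i j|f f_orth].
  (* The conjugate in [Phi] produces the transposed entry, hence the use of symmetry. *)
  rewrite dotmxE mxE laplacianC LE mul_mx_diag mxE.
  rewrite (bigID (fun k : 'I_n => (k < d)%N)) /= [X in _ + X]big1 ?addr0.
    rewrite (big_ord_narrow le_dn); apply: eq_bigr => l _.
    rewrite !mxE !PhiE' rmorphM /= conjCK mulrACA.
    rewrite (geC0_conj (_ : 0 <= sqrtC _)) ?sqrtC_ge0 // -expr2 sqrtCK.
    by rewrite /w; ring.
  move=> k; rewrite -lam_neq0 negbK => /eqP lam0.
  by rewrite !mxE lam0 mulr0 mul0r.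
apply/rowP => k; rewrite mxE.
(* Testing the coefficients against column [w k] isolates coordinate [k] of [f], up to a factor that
   is nonzero because [w k] is among the first [d] indices. *)
have : \sum_i (M i (w k))^* * dotmx f (Phi i) = f 0 k * (sqrtC (lam 0 (w k)))^*.
  under eq_bigr do rewrite dotmxE mxE mulr_sumr.
  rewrite exchange_big (bigD1 k) //= [X in _ + X]big1 ?addr0 => [|l lk].
    rewrite (eq_bigr (fun i => f 0 k * (sqrtC (lam 0 (w k)))^* *
        ((M i (w k))^* * M i (w k)))).
      by rewrite -mulr_sumr MM eqxx mulr1.
    by move=> i _; rewrite !mxE PhiE' rmorphM /= conjCK; ring.
  rewrite (eq_bigr (fun i => f 0 l * (sqrtC (lam 0 (w l)))^* *
      ((M i (w k))^* * M i (w l)))).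
    rewrite -mulr_sumr MM (_ : w k == w l = false) ?mulr0 //.
    by apply: contraNF lk => /eqP/(congr1 val) /= kl; apply/eqP/val_inj.
  by move=> i _; rewrite !mxE PhiE' rmorphM /= conjCK; ring.
rewrite big1 => [|i _]; last by rewrite f_orth mulr0.
move/esym/eqP; rewrite mulf_eq0 conjC_eq0 sqrtC_eq0.
rewrite (negPf (_ : lam 0 (w k) != 0)).
  by rewrite orbF => /eqP.
by rewrite lam_neq0 /=.
Qed.

(** Otherwise the component of [j] is the whole graph, which then counts as a single component. *)
Lemma other_component (n : nat) (G : sgraph n) j :
  (1 < num_components G)%N -> exists c, ~~ connect (adj G) c j.
Proof.
move=> G_gt1; apply/existsP; apply: contraTT G_gt1.
rewrite negb_exists => /forallP all_conn; rewrite -leqNgt.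
have conn_sym := sym_connect_sym (@adj_sym _ G).
rewrite -(n_comp_connect conn_sym j) /num_components eq_leq //.
apply: eq_n_comp_r => c; rewrite inE /in_mem /= conn_sym.
by have := all_conn c; rewrite negbK => ->.
Qed.

Theorem theorem3p3 (R : realType) (n k : nat) (G : sgraph n)
    (hk : (1 < k)%N) (hkn : (k < n)%N) (hG : num_components G = k)
    (Phi : 'I_n -> 'rV[R[i]]_(n - k)) (hPhi : is_LG_frame G Phi) :
  spectrally_optimal1 Phi (canonical_dual Phi) /\
  exists Psi : 'I_n -> 'rV[R[i]]_(n - k),
    Psi <> canonical_dual Phi /\ spectrally_optimal1 Phi Psi.
Proof.
have d0 : (0 < n - k)%N by rewrite subn_gt0.
have [gram span] := LG_frame_gram hPhi.
have dual := canonical_dual_is_dual span.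
have att : attains_component_bound G Phi (canonical_dual Phi).
  apply: selfadjoint_dual_diag => // i j; exact: canonical_dual_selfadjoint.
split; first exact: attains_component_bound_optimal.
(* If all [Phi j] were zero, spanning would make the all-ones vector zero, against [d0]. *)
have [j Phij] : exists j, Phi j != 0.
  apply/existsP; apply: contraT; rewrite negb_exists => /forallP Phi0.
  have /rowP/(_ (Ordinal d0)) : const_mx 1 = 0 :> 'rV[R[i]]_(n - k).
    apply: span => i; have := Phi0 i; rewrite negbK => /eqP->.
    exact: linear0r.
  by rewrite !mxE => /eqP; rewrite oner_eq0.
have [c ncj] : exists c, ~~ connect (adj G) c j.
  by apply: other_component; rewrite hG.
pose U i := (connect (adj G) c i)%:R *: Phi j.
pose Psi i := canonical_dual Phi i + U i.
(* [U] is constant on one component and zero elsewhere; [Phi] sums to zero over that component, so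
   [U] contributes to neither reconstruction formula. *)
have U_synth f : \sum_i dotmx f (Phi i) *: U i = 0.
  transitivity (dotmx f (\sum_(i | connect (adj G) c i) Phi i) *: Phi j).
    rewrite dotmx_sumr scaler_suml [RHS]big_mkcond; apply: eq_bigr => i _.
    by rewrite /U; case: ifP => _; rewrite ?scale1r ?scale0r ?scaler0.
  by rewrite (frame_component_sum gram) linear0r scale0r.
have U_analysis f : \sum_i dotmx f (U i) *: Phi i = 0.
  transitivity (\sum_(i | connect (adj G) c i) dotmx f (Phi j) *: Phi i).
    rewrite [RHS]big_mkcond; apply: eq_bigr => i _.
    by rewrite /U; case: ifP => _; rewrite ?scale1r // scale0r linear0r scale0r.
  by rewrite -scaler_sumr (frame_component_sum gram) scaler0.
have dual2 f : f = \sum_i dotmx f (Psi i) *: Phi i.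
  under eq_bigr do rewrite linearDr scalerDl.
  by rewrite big_split /= U_analysis addr0; exact: (dual.2 f).2.
exists Psi; split.
  move=> PsiE; have /eqP : Psi c = canonical_dual Phi c by rewrite PsiE.
  by rewrite /Psi /U connect0 scale1r -subr_eq0 addrAC subrr add0r (negPf Phij).
apply: (attains_component_bound_optimal gram d0) => [|i].
  split; first exact: dual_is_frame dual2.
  move=> f; split=> //; under eq_bigr do rewrite scalerDr.
  by rewrite big_split /= U_synth addr0; exact: (dual.2 f).1.
(* On the component of [c] the diagonal changes by [dotmx (Phi j) (Phi i)], a Laplacian entry
   between distinct components. *)
rewrite /Psi linearDl /= att /U; case: (boolP (connect (adj G) c i)) => ci.
  rewrite scale1r gram laplacian_eq0 ?addr0 //.
  rewrite (sym_connect_sym (@adj_sym _ G)).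
  by apply: contra ncj; exact: connect_trans.
by rewrite scale0r linear0l addr0.
Qed.
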